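(* Let $\alpha$ be a parameter (a complex number) and let $\mathcal F=(F_1,F_2)$ be a pair of finite sets of nonnegative integers. Then, as polynomials in $x$, $$\mathtt{L}_{\mathcal F,x}^{\alpha}=(-1)^{w_{\mathcal F}}\,\mathtt{L}_{I(\mathcal F),-x}^{-\alpha-\max F_1-\max F_2-2}.$$
   Context: The Laguerre polynomials (standard normalization) are $$L_n^\alpha(x)=\sum_{j=0}^n\frac{(-x)^j}{j!}\binom{n+\alpha}{n-j},\qquad n\ge 0.$$ Let $\mathcal F=(F_1,F_2)$ be a pair of finite sets of nonnegative integers, where $F_i$ has $k_i$ elements, and put $k=k_1+k_2$. The quasi Wronskian is $$\mathtt{L}_{\mathcal F,x}^{\alpha}=(-1)^{\sum_{f\in F_1}f}\det A,$$ where $A$ is the $k\times k$ matrix whose first $k_1$ rows are indexed by $f\in F_1$ (in increasing order), with entries $(L_f^\alpha)^{(j-1)}(x)$ (the $(j-1)$-th derivative of $L_f^\alpha$ evaluated at $x$), $1\le j\le k$, and whose last $k_2$ rows are indexed by $f\in F_2$ (in increasing order), with entries $L_f^{\alpha+j-1}(-x)$, $1\le j\le k$. It is a polynomial in $x$; the subscript $-x$ means evaluation of this polynomial at $-x$. For a finite set $F$ of nonnegative integers with $|F|$ elements, $$w_F=\sum_{f\in F}f-\binom{|F|}{2},\qquad I(F)=\{0,1,\dots,\max F\}\setminus\{\max F-f:f\in F\},$$ and for the pair, $w_{\mathcal F}=w_{F_1}+w_{F_2}$ and $I(\mathcal F)=(I(F_1),I(F_2))$. Conventions: the determinant of an empty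 matrix is $1$; $\max\emptyset=-1$, so that $I(\emptyset)=\emptyset$. *)

(* Defs.v *)
From mathcomp Require Export all_boot all_order all_algebra.
From mathcomp Require Export finmap complex reals.

Set Implicit Arguments.
Unset Strict Implicit.
Unset Printing Implicit Defensive.

Import GRing.Theory.

Local Open Scope fset_scope.
Local Open Scope ring_scope.

(* a(a-1)...(a-m+1)/m! for an arbitrary upper argument a; 'C(n, m) requires
   n to be a natural number. *)
Definition gbinom (K : numFieldType) (a : K) (m : nat) : K :=
  (\prod_(i < m) (a - i%:R)) / m`!%:R.

Definition laguerre (K : numFieldType) (n : nat) (alpha : K) : {poly K} :=
  \sum_(j < n.+1)
     (gbinom (n%:R + alpha) (n - j) / j`!%:R) *: (- 'X) ^+ j.

Definition fenum (F : {fset nat}) : seq nat := sort leq (enum_fset F).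

Definition qwronsk_mx (K : numFieldType) (alpha : K) (F1 F2 : {fset nat}) :
    'M[{poly K}]_(#|` F1| + #|` F2|) :=
  col_mx
    (\matrix_(i < #|` F1|, j < #|` F1| + #|` F2|)
       (laguerre (nth 0%N (fenum F1) i) alpha)^`(j))
    (\matrix_(i < #|` F2|, j < #|` F1| + #|` F2|)
       (laguerre (nth 0%N (fenum F2) i) (alpha + j%:R) \Po (- 'X))).

(* The quasi Wronskian, as a polynomial in the variable 'X. *)
Definition qwronsk (K : numFieldType) (alpha : K)
    (FF : {fset nat} * {fset nat}) : {poly K} :=
  (-1) ^+ (\sum_(f <- FF.1) f)%N * \det (qwronsk_mx alpha FF.1 FF.2).

(* Integer-valued because the maximum of the empty set is -1. *)
Definition fmax (F : {fset nat}) : int :=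
  if F == fset0 then -1 else (\max_(f <- F) f)%N%:Z.

Definition wset (F : {fset nat}) : int :=
  (\sum_(f <- F) f)%N%:Z - 'C(#|` F|, 2)%:Z.

Definition wpair (FF : {fset nat} * {fset nat}) : int :=
  wset FF.1 + wset FF.2.

(* I(F); the truncated subtraction m - f is exact since f <= m on F. *)
Definition iset (F : {fset nat}) : {fset nat} :=
  if F == fset0 then fset0 else
  let m := (\max_(f <- F) f)%N in
  [fset i in iota 0 m.+1] `\` [fset (m - f)%N | f in F].

Definition ipair (FF : {fset nat} * {fset nat}) : {fset nat} * {fset nat} :=
  (iset FF.1, iset FF.2).

(* Main.v *)
Require Import Defs.
From mathcomp Require Import zify ring.

(** Write m and n for max F1 + 1 and max F2 + 1, and N = m + n.  Stack the rows
    (L_f^a)^(j)(x), f < m, on the rows L_f^(a+j)(-x), f < n, where 0 <= j < N: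
    this is a square matrix Phi, and the quasi Wronskian of (F1, F2) is, up to
    sign, the minor of Phi on its first k columns and on the rows selected by
    F1 and F2.  The dual matrix Y is made in the same way with the parameter
    b = - a - m - n, the variable -x, each of its two blocks of rows turned
    upside down, and the first block multiplied by a sign; the minor of Y on its first N - k columns and on the rows that
    F1 and F2 leave out is the quasi Wronskian of (I(F1), I(F2)), up to sign.
    So the theorem asserts that two complementary minors agree up to sign.

    The reason is that Phi^T Y is zero strictly above its antidiagonal, and one
    on it ([sum_wronsk_row_dual_row]).  Conceptually, the generating function of
    the Laguerre polynomials turns the rows of Phi into the functionals that
    read off the Taylor coefficients at 0 and at 1 of a polynomial p(s) of
    degree < N, after multiplication by a unit and in suitable local parameters;
    column j is p = s^j.  The residue theorem for p q ds / (s^m (s-1)^n) then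
    says that the sum of the two local pairings is minus the residue at
    infinity, which vanishes when deg p + deg q < N - 1.  Below, this becomes the
    convolution identity [laguerre_conv], where the variable cancels, followed
    by a cancellation between two binomial coefficients.

    Orthogonality makes complementary minors proportional
    ([ndet_complement]), the factor being det Phi.  Replacing the columns s^j by
    the Newton basis 1, s, ..., s^m, s^m (s-1), s^m (s-1)^2, ... makes Phi
    triangular, whence det Phi = (-1)^C(m, 2) ([ndet_wronsk_row]).  What remains
    is the bookkeeping of signs: the shuffle that separates selected from
    omitted rows, the reversals, and the signs of the quasi Wronskians. *)

Set Implicit Arguments.
Unset Strict Implicit.
Unset Printing Implicit Defensive.

Import GRing.Theory Num.Theory.

Local Open Scope fset_scope.
Local Open Scope ring_scope.

(** * Determinants of matrices with entries indexed by natural numbers *)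

(** Rows and columns are indexed by [nat], so that sizes can be rewritten along
    equalities such as k + r = m + n without casting matrices. *)
Definition ndet (R : comNzRingType) (n : nat) (E : nat -> nat -> R) : R :=
  \det (\matrix_(i < n, j < n) E i j).

Lemma eq_ndet (R : comNzRingType) n (E E' : nat -> nat -> R) :
  (forall i j, (i < n)%N -> (j < n)%N -> E i j = E' i j) ->
  ndet n E = ndet n E'.
Proof. by move=> EE'; congr (\det _); apply/matrixP=> i j; rewrite !mxE EE'. Qed.

Lemma ndet_antitrig (R : comNzRingType) n (G : nat -> nat -> R) :
  (forall i j, ((i + j).+1 < n)%N -> G i j = 0) ->
  (forall i j, (i + j).+1 = n -> G i j = 1) ->
  ndet n G = (-1) ^+ 'C(n, 2).
Proof.
elim: n G => [|n IHn] G G0 G1; first by rewrite /ndet det_mx00.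
rewrite /ndet (expand_det_row _ ord0) big_ord_recr big1 /= ?add0r; last first.
  by move=> j _; rewrite !mxE G0 ?mul0r //= add0n ltnS ltn_ord.
rewrite !mxE /= G1 // mul1r /cofactor /= add0n binS bin1 addnC exprD.
congr (_ * _).
rewrite -(IHn (fun i j => G i.+1 j)) /ndet.
- congr (\det _); apply/matrixP => i j; rewrite !mxE /= /bump /= add1n.
  by rewrite leqNgt ltn_ord.
- by move=> i j lt; apply: G0; rewrite addSn ltnS.
- by move=> i j e; apply: G1; rewrite addSn e.
Qed.

(** Expansion along the last column, whose only nonzero entry is in the row
    that selects [n]. *)
Lemma ndet_insert (R : comNzRingType) (a b : seq nat) (n : nat) :
  size (a ++ b) = n -> n \notin a ++ b ->
  ndet n.+1 (fun i j => (nth 0%N (a ++ n :: b) i == j)%:R) =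
  (-1) ^+ (size a + n) *
    ndet n (fun i j => (nth 0%N (a ++ b) i == j)%:R) :> R.
Proof.
move=> sz nab.
have lt_a : (size a < n.+1)%N by rewrite -sz size_cat ltnS leq_addr.
pose i0 := Ordinal lt_a.
have nth_bump i : nth 0%N (a ++ n :: b) (bump (size a) i) = nth 0%N (a ++ b) i.
  rewrite /bump !nth_cat; case: (leqP (size a) i) => h /=.
    by rewrite add1n ltnNge (leqW h) /= subSn.
  by rewrite add0n h.
rewrite /ndet (expand_det_col _ ord_max) (bigD1 i0) //= big1 ?addr0.
  rewrite mxE /= nth_cat ltnn subnn /= eqxx mul1r /cofactor /=.
  congr (_ * \det _); apply/matrixP => i j; rewrite !mxE /= nth_bump.
  by rewrite [bump n j]/bump leqNgt ltn_ord.
move=> i /eqP neq; rewrite mxE /=.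
case: (unliftP i0 i) neq => [k ->|->] // _; rewrite /= nth_bump.
suff /negPf -> : nth 0%N (a ++ b) k != n by rewrite mul0r.
by apply: contraNneq nab => <-; rewrite mem_nth // sz ltn_ord.
Qed.

(** The rearrangement of 0, ..., n-1 that puts the selected indices first. *)
Definition shuffle (P : pred nat) (n : nat) : seq nat :=
  [seq c <- iota 0 n | P c] ++ [seq c <- iota 0 n | ~~ P c].

Lemma size_shuffle P n : size (shuffle P n) = n.
Proof. by rewrite size_cat !size_filter count_predC size_iota. Qed.

Lemma mem_shuffle P n c : (c \in shuffle P n) = (c < n)%N.
Proof. by rewrite mem_cat !mem_filter -andb_orl orbN mem_iota. Qed.

(** The sign of the shuffle: the number of inversions is the sum of c - i over
    the selected elements c, where i is the rank of c among them, and the ranks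
    add up to C(k, 2) if k elements are selected. *)
Lemma ndet_shuffle_mx (R : comNzRingType) P n :
  ndet n (fun i j => (nth 0%N (shuffle P n) i == j)%:R) =
  (-1) ^+ (\sum_(c <- [seq c <- iota 0 n | P c]) c +
            'C(size [seq c <- iota 0 n | P c], 2))%N :> R.
Proof.
elim: n => [|n IHn]; first by rewrite /ndet det_mx00 /= big_nil.
have nin : n \notin shuffle P n by rewrite mem_shuffle ltnn.
move: nin (size_shuffle P n) IHn.
rewrite /shuffle -(addn1 n) iotaD !filter_cat /= add0n.
set A := filter _ _; set B := filter _ _ => nin sz IHn.
rewrite addn1; case: ifP => Pn /=.
  rewrite cats0 -catA cat1s ndet_insert // IHn -exprD.
  rewrite big_cat big_seq1 size_cat addn1 binS bin1 /=.
  by congr (_ ^+ _); lia.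
rewrite !cats0 catA -[X in X ++ _](cats0 (A ++ B)) -catA ndet_insert ?cats0 //.
by rewrite sz IHn -exprD -[LHS]signr_odd -[RHS]signr_odd !oddD addbb.
Qed.

Lemma ndet_shuffle (R : comNzRingType) P n (E : nat -> nat -> R) :
  ndet n (fun i j => E (nth 0%N (shuffle P n) i) j) =
  (-1) ^+ (\sum_(c <- [seq c <- iota 0 n | P c]) c +
            'C(size [seq c <- iota 0 n | P c], 2))%N * ndet n E.
Proof.
rewrite -ndet_shuffle_mx /ndet -det_mulmx; congr (\det _).
apply/matrixP => i j; rewrite !mxE.
have lt : (nth 0%N (shuffle P n) i < n)%N.
  by rewrite -(mem_shuffle P) mem_nth // size_shuffle.
rewrite (bigD1 (Ordinal lt)) //= big1 ?addr0 => [|c /eqP neq].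
  by rewrite !mxE eqxx mul1r.
rewrite !mxE; case: eqP => [e|_]; last by rewrite mul0r.
by case: neq; apply: val_inj.
Qed.

(** Jacobi's identity for complementary minors, in a form that uses only the
    vanishing of one block of G = E^T Y: multiplying E^T by the block matrix
    (1, Y_up; 0, Y_down) then gives a lower block triangular matrix, and both
    sides are its determinant. *)
Lemma ndet_complement (R : comNzRingType) k r (E Y G : nat -> nat -> R) :
  (forall i j, (i < k + r)%N -> (j < r)%N ->
     \sum_(c < k + r) E c i * Y c j = G i j) ->
  (forall i j, (i < k)%N -> (j < r)%N -> G i j = 0) ->
  ndet (k + r) E * ndet r (fun i => Y (k + i)%N) =
  ndet k E * ndet r (fun i => G (k + i)%N).
Proof.
move=> EY G0; pose X : 'M_(k + r) := \matrix_(i, j) E i j.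
pose Z : 'M_(k + r, r) := \matrix_(i, j) Y i j.
have XZ : X^T *m Z = col_mx 0 (\matrix_(i, j) G (k + i)%N j).
  apply/matrixP => i j; rewrite !mxE.
  under eq_bigr => c _ do rewrite !mxE.
  rewrite EY //; case: splitP => i' ei; rewrite mxE ei //.
  by rewrite G0.
have dX : ndet (k + r) E = \det X^T by rewrite det_tr.
have dY : ndet r (fun i => Y (k + i)%N) =
    \det (block_mx 1%:M (usubmx Z) 0 (dsubmx Z) : 'M_(k + r)).
  rewrite det_ublock det1 mul1r /ndet; congr (\det _).
  by apply/matrixP => i j; rewrite !mxE.
have dE : ndet k E = \det (ulsubmx X)^T.
  by rewrite det_tr /ndet; congr (\det _); apply/matrixP => i j; rewrite !mxE.
rewrite dX dY dE -det_mulmx /ndet -(det_lblock _ (ursubmx X)^T); congr (\det _).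
rewrite !block_mxEh mul_mx_row vsubmxK XZ; congr row_mx.
by rewrite -[in LHS](submxK X) tr_block_mx mul_block_col !mulmx1 !mulmx0 !addr0.
Qed.

(** * Generalized binomial coefficients *)

Lemma natrS_neq0 (K : numFieldType) (n : nat) : n.+1%:R != 0 :> K.
Proof. by rewrite pnatr_eq0. Qed.

Lemma factr_neq0 (K : numFieldType) (n : nat) : n`!%:R != 0 :> K.
Proof. by rewrite pnatr_eq0 -lt0n fact_gt0. Qed.

Lemma gbinom0 (K : numFieldType) (a : K) : gbinom a 0 = 1.
Proof. by rewrite /gbinom big_ord0 divr1. Qed.

Lemma gbinomS (K : numFieldType) (a : K) m :
  gbinom a m.+1 = gbinom a m * (a - m%:R) / m.+1%:R.
Proof.
rewrite /gbinom big_ord_recr /= factS natrM invfM; ring.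
Qed.

Lemma mul_gbinomS (K : numFieldType) (a : K) m :
  m.+1%:R * gbinom (a + 1) m.+1 = (a + 1) * gbinom a m.
Proof.
rewrite /gbinom big_ord_recl /= factS natrM.
under eq_bigr => i _ do
  rewrite /bump /= add1n -addn1 natrD opprD addrACA subrr addr0.
by field; rewrite factr_neq0 nat1r natrS_neq0.
Qed.

Lemma gbinom_pascal (K : numFieldType) (a : K) m :
  gbinom (a + 1) m.+1 = gbinom a m.+1 + gbinom a m.
Proof.
apply: (mulfI (natrS_neq0 K m)); rewrite mul_gbinomS gbinomS.
by rewrite -natr1; field; rewrite natr1 natrS_neq0.
Qed.

Lemma gbinom_nat (K : numFieldType) (n m : nat) :
  gbinom n%:R m = 'C(n, m)%:R :> K.
Proof.
elim: n m => [|n IHn] [|m]; rewrite ?gbinom0 ?bin0 //.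
  by rewrite /gbinom big_ord_recl subrr !mul0r bin0n.
by rewrite -natr1 gbinom_pascal !IHn binS natrD.
Qed.

Lemma gbinomN (K : numFieldType) (n m : nat) :
  gbinom (- n.+1%:R) m = (-1) ^+ m * 'C(n + m, m)%:R :> K.
Proof.
elim: m => [|m IHm]; first by rewrite gbinom0 bin0 mulr1.
apply: (mulfI (natrS_neq0 K m)); rewrite gbinomS IHm mulrCA.
rewrite mulrV ?unitfE ?natrS_neq0 // mulr1 mulrCA -natrM addnS.
rewrite -mul_bin_diag natrM exprS.
by rewrite -!natr1 natrD; ring.
Qed.

(** Chu-Vandermonde in its multiset form, that is (1-t)^(-a-1) (1-t)^(-b-1) =
    (1-t)^(-a-b-2).  Both sides satisfy n S_n = (n + a + b + 1) S_(n-1); for the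
    left side, write n as i + (n - i). *)
Lemma gbinom_conv (K : numFieldType) (a b : K) n :
  \sum_(i < n.+1) gbinom (i%:R + a) i * gbinom ((n - i)%:R + b) (n - i) =
  gbinom (n%:R + (a + b + 1)) n.
Proof.
elim: n => [|n IHn]; first by rewrite big_ord1 !gbinom0 mulr1.
have rise (c : K) m : m.+1%:R * gbinom (m.+1%:R + c) m.+1 =
    (m.+1%:R + c) * gbinom (m%:R + c) m.
  by rewrite [m.+1%:R + c](_ : _ = m%:R + c + 1) ?mul_gbinomS // -natr1 addrAC.
apply: (mulfI (natrS_neq0 K n)); rewrite rise -IHn !mulr_sumr.
pose f i := gbinom (i%:R + a) i; pose g i := gbinom (i%:R + b) i.
transitivity (\sum_(i < n.+2) (i%:R * f i * g (n.+1 - i)%N +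
     f i * ((n.+1 - i)%:R * g (n.+1 - i)%N))).
  apply: eq_bigr => i _; rewrite /f /g.
  have -> : n.+1%:R = i%:R + (n.+1 - i)%:R :> K.
    by rewrite -natrD subnKC // -ltnS.
  by ring.
rewrite big_split /= big_ord_recl mul0r mul0r add0r.
rewrite [X in _ + X]big_ord_recr /= subnn mul0r mulr0 addr0 -big_split /=.
apply: eq_bigr => i _; rewrite /bump /= add1n subSS /f /g rise.
have le_in : (i <= n)%N by rewrite -ltnS ltn_ord.
have -> : n.+1%:R = i%:R + (n - i)%:R + 1 :> K.
  by rewrite -natrD subnKC // natr1.
by rewrite subSn // rise -!natr1; ring.
Qed.

(** * Laguerre polynomials *)

Lemma coef_laguerre (K : numFieldType) n (a : K) j :
  (laguerre n a)`_j =
  if (j <= n)%N then (-1) ^+ j * gbinom (n%:R + a) (n - j) / j`!%:R else 0.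
Proof.
have -> : laguerre n a =
    \poly_(j < n.+1) ((-1) ^+ j * gbinom (n%:R + a) (n - j) / j`!%:R).
  rewrite poly_def; apply: eq_bigr => i _.
  by rewrite (exprNn 'X) -(rmorph_sign polyC) mul_polyC scalerA mulrC mulrA.
by rewrite coef_poly ltnS.
Qed.

Lemma laguerre0 (K : numFieldType) (a : K) : laguerre 0 a = 1.
Proof.
by apply/polyP=> -[|j]; rewrite coef_laguerre coef1 // subnn gbinom0 mul1r divr1.
Qed.

Lemma laguerre_pascal (K : numFieldType) n (a : K) :
  laguerre n.+1 (a + 1) = laguerre n.+1 a + laguerre n (a + 1).
Proof.
apply/polyP=> j; rewrite coefD !coef_laguerre.
case: (ltngtP j n.+1) => [| |->]; last first.
- by rewrite ltnn addr0 subnn !gbinom0.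
- by move=> lt; rewrite leqNgt ltnW //= addr0.
rewrite ltnS => le_jn; rewrite le_jn subSn // addrA gbinom_pascal -!natr1.
by rewrite mulrDr mulrDl (addrC a) addrA.
Qed.

Lemma deriv_laguerre (K : numFieldType) n (a : K) :
  (laguerre n.+1 a)^`() = - laguerre n (a + 1).
Proof.
apply/polyP=> j; rewrite coef_deriv coefN !coef_laguerre ltnS subSS.
case: ifP => _; last by rewrite mul0rn oppr0.
rewrite -(natr1 n) (addrC a) addrA factS natrM exprS -mulr_natr.
by field; rewrite factr_neq0 nat1r natrS_neq0.
Qed.

(** The coefficient of t^n in t^i G(t), for G the generating function of the
    polynomials L_k^a; its vanishing for n < i lets Pascal's rule hold without a
    side condition. *)
Definition laguerre_shift (K : numFieldType) (n i : nat) (a : K) : {poly K} :=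
  if (i <= n)%N then laguerre (n - i) a else 0.

Lemma laguerre_shift_pascal (K : numFieldType) n i (a : K) :
  laguerre_shift n i (a + 1) =
  laguerre_shift n i a + laguerre_shift n i.+1 (a + 1).
Proof.
rewrite /laguerre_shift; case: (ltngtP i n) => [lt|lt|->]; last first.
- by rewrite subnn !laguerre0 addr0.
- by rewrite addr0.
by rewrite -(prednK (_ : 0 < n - i)%N) ?subn_gt0 // subnS laguerre_pascal.
Qed.

Lemma derivn_laguerre (K : numFieldType) n j (a : K) :
  (laguerre n a)^`(j) = (-1) ^+ j * laguerre_shift n j (a + j%:R).
Proof.
elim: j => [|j IHj]; first by rewrite mul1r addr0 /laguerre_shift subn0.
rewrite derivnS IHj exprS -mulrA -mulrCA -signr_odd !mulr_sign /laguerre_shift.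
have drv : (if (j <= n)%N then laguerre (n - j) (a + j%:R) else 0)^`() =
    - if (j < n)%N then laguerre (n - j.+1) (a + j.+1%:R) else 0.
  case: (ltngtP j n) => [lt|lt|->]; first 1 last.
  - by rewrite derivC oppr0.
  - by rewrite subnn laguerre0 derivC oppr0.
  by rewrite -[(n - j)%N]prednK ?subn_gt0 // deriv_laguerre subnS -addrA natr1.
by case: ifP => _; rewrite ?derivN drv mulN1r ?opprK.
Qed.

Lemma laguerre_at0 (K : numFieldType) n (a : K) :
  (laguerre n a).[0] = gbinom (n%:R + a) n.
Proof. by rewrite horner_coef0 coef_laguerre subn0 mul1r divr1. Qed.

(** The product of the generating functions (1-t)^(-a-1) exp(-xt/(1-t)) and
    (1-t)^(-b-1) exp(xt/(1-t)) does not involve x.  By induction on n the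
    derivative of the sum is a difference of two equal constants, so the sum
    equals its value at 0. *)
Lemma laguerre_conv (K : numFieldType) n (a b : K) :
  \sum_(i < n.+1) laguerre i a * (laguerre (n - i) b \Po (- 'X)) =
  (gbinom (n%:R + (a + b + 1)) n)%:P.
Proof.
have laguerre_deriv i c : (laguerre i c)^`() =
    - (if i is m.+1 then laguerre m (c + 1) else 0) :> {poly K}.
  by case: i => [|m]; rewrite ?deriv_laguerre // laguerre0 derivC oppr0.
elim: n a b => [|n IHn] a b.
  by rewrite big_ord1 !laguerre0 mul1r comp_polyC gbinom0.
set p := LHS.
have p_const : p^`() = 0.
  rewrite /p raddf_sum /=.
  under eq_bigr => i _ do
    rewrite derivM deriv_comp derivN derivX mulrN1 !laguerre_deriv raddfN opprK.
  rewrite big_split /= big_ord_recl [X in _ + X]big_ord_recr /=.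
  rewrite oppr0 mul0r add0r subnn comp_polyC polyC0 mulr0 addr0.
  rewrite (eq_bigr (fun i : 'I_n.+1 =>
      - (laguerre i (a + 1) * (laguerre (n - i) b \Po (- 'X))))); last first.
    by move=> i _; rewrite /bump /= add1n subSS mulNr.
  rewrite [X in _ + X](eq_bigr (fun i : 'I_n.+1 =>
      laguerre i a * (laguerre (n - i) (b + 1) \Po (- 'X)))); last first.
    by move=> i _; rewrite subSn // -ltnS.
  by rewrite sumrN !IHn (addrAC a 1 b) (addrA a b 1) addNr.
have -> : p = (p.[0])%:P.
  apply/polyP => -[|j]; rewrite coefC ?horner_coef0 //=.
  have := congr1 (fun q : {poly K} => q`_j) p_const; rewrite coef_deriv coef0.
  by move/eqP; rewrite mulrn_eq0 /= => /eqP.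
congr (_ %:P); rewrite /p horner_sum -gbinom_conv; apply: eq_bigr => i _.
by rewrite hornerM horner_comp hornerN hornerX oppr0 !laguerre_at0.
Qed.

(** * The two dual families of rows *)

(** Convolution with shifts, obtained from [laguerre_conv] by viewing the two
    families as coefficients of truncated series in t, multiplied by t^i and by
    t^j. *)
Lemma laguerre_shift_conv (K : numFieldType) m i j (a b : K) :
  \sum_(c < m.+1) laguerre_shift c i a * (laguerre_shift (m - c) j b \Po (- 'X)) =
  if (i + j <= m)%N
  then (gbinom ((m - (i + j))%:R + (a + b + 1)) (m - (i + j)))%:P else 0.
Proof.
pose A : {poly {poly K}} := \poly_(c < m.+1) laguerre c a.
pose B : {poly {poly K}} := \poly_(c < m.+1) (laguerre c b \Po (- 'X)).
have coefA c : (c <= m)%N -> ('X^i * A)`_c = laguerre_shift c i a.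
  move=> le_cm; rewrite coefXnM coef_poly /laguerre_shift.
  case: (leqP i c) => //= _.
  by rewrite ltnS (leq_trans (leq_subr i c)).
have coefB c : (c <= m)%N -> ('X^j * B)`_c = laguerre_shift c j b \Po (- 'X).
  move=> le_cm; rewrite coefXnM coef_poly /laguerre_shift.
  case: (leqP j c) => //= _; last first.
    by rewrite comp_poly0.
  by rewrite ltnS (leq_trans (leq_subr j c)).
transitivity (('X^i * A * ('X^j * B))`_m).
  rewrite coefM; apply: eq_bigr => c _.
  by rewrite coefA ?coefB ?leq_subr // -ltnS.
rewrite mulrACA -exprD coefXnM; case: (leqP (i + j) m) => //= _.
rewrite coefM -laguerre_conv; apply: eq_bigr => c _.
rewrite !coef_poly !ltnS; have le_c := leq_subr (i + j) m.
have lec : (c <= m - (i + j))%N by rewrite -ltnS.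
by rewrite (leq_trans lec le_c) (leq_trans (leq_subr _ _) le_c).
Qed.

(** The matrix Phi: its first [m] rows carry the derivatives, and row [m + f] is
    that of L_f^(a+j)(-x). *)
Definition wronsk_row (K : numFieldType) (m : nat) (a : K) (c j : nat) :
    {poly K} :=
  if (c < m)%N then (laguerre c a)^`(j)
  else laguerre (c - m) (a + j%:R) \Po (- 'X).

(** The matrix Y.  Each block is listed in reverse order since a convolution
    pairs index c with m - 1 - c; the sign on the first block is the one for which
    the contributions of the two blocks cancel. *)
Definition dual_row (K : numFieldType) (m n : nat) (b : K) (c j : nat) :
    {poly K} :=
  if (c < m)%N then
    (-1) ^+ (m + n).+1 * ((laguerre (m - c.+1) b)^`(j) \Po (- 'X))
  else laguerre (m + n - c.+1) (b + j%:R).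

(** The residue theorem in coefficients.  With d = i + j, the first block gives
    +-binom(-n, m-1-d) if d < m and 0 otherwise, and for n > 0 the second
    block gives binom(d - m, n - 1).  For d < m both are, up to opposite signs,
    C(m + n - d - 2, n - 1); for d >= m only the second remains, and it is
    C(d - m, n - 1), which is 0 or 1 as d + 1 < m + n or d + 1 = m + n. *)
Lemma sum_wronsk_row_dual_row (K : numFieldType) m n (a : K) i j :
  ((i + j).+1 <= m + n)%N ->
  \sum_(c < m + n) wronsk_row m a c i * dual_row m n (- a - m%:R - n%:R) c j =
  ((i + j).+1 == m + n)%N%:R.
Proof.
move=> le_ij; set b := - a - _ - _.
rewrite big_split_ord /=.
have -> : \sum_(c < m) wronsk_row m a c i * dual_row m n b c j =
    if (i + j < m)%N then ((-1) ^+ (m + n + (i + j)).+1 *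
        gbinom (- n%:R) (m - (i + j).+1))%:P else 0.
  case: m @b le_ij => [|m] b le_ij; first by rewrite big_ord0.
  (* the derivatives contribute the sign (-1)^(i+j) *)
  transitivity ((-1) ^+ (m.+1 + n + (i + j)).+1 *
      \sum_(c < m.+1) laguerre_shift c i (a + i%:R) *
        (laguerre_shift (m - c) j (b + j%:R) \Po (- 'X))).
    rewrite mulr_sumr; apply: eq_bigr => c _.
    rewrite /wronsk_row /dual_row ltn_ord subSS !derivn_laguerre.
    by rewrite rmorphM rmorph_sign /= !(exprS, exprD); ring.
  rewrite laguerre_shift_conv ltnS; case: leqP => [le|_]; last by rewrite mulr0.
  rewrite subSS [in RHS]polyCM (rmorph_sign polyC); congr (_ * (gbinom _ _)%:P).
  by rewrite natrB // natrD /b; ring.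
have -> : \sum_(c < n) wronsk_row m a (m + c)%N i * dual_row m n b (m + c)%N j =
    if n is k.+1 then (gbinom ((i + j)%:R - m%:R) k)%:P else 0.
  case: n @b le_ij => [|n] b le_ij; first by rewrite big_ord0.
  transitivity ((gbinom (n%:R + ((b + j%:R) + (a + i%:R) + 1)) n)%:P : {poly K}).
    rewrite -laguerre_conv (reindex_inj rev_ord_inj) /=; apply: eq_bigr => c _.
    rewrite /wronsk_row /dual_row !ltnNge !leq_addr /= mulrC addKn subSS.
    by congr (laguerre _ _ * _); have := ltn_ord c; lia.
  by congr (gbinom _ _)%:P; rewrite /b natrD; ring.
clear b; case: n le_ij => [|k] le_ij.
  (* without a second block, the binomial coefficient binom(0, m-1-d) of the
     first one vanishes by itself for d < m - 1 *)
  rewrite [LHS]addr0; rewrite !addn0 in le_ij *.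
  rewrite le_ij oppr0 (gbinom_nat _ 0) bin0n.
  rewrite subn_eq0 eqn_leq le_ij /= -addnS exprD.
  case: leqP => [le|_]; last by rewrite mulr0.
  have -> : m = (i + j).+1 by apply/eqP; rewrite eqn_leq le le_ij.
  by rewrite -expr2 sqrr_sign mulr1.
case: (ltnP (i + j) m) => [lt|le].
  have [e em] : exists e, m = (i + j + e).+1 by exists (m - (i + j).+1)%N; lia.
  have -> : (i + j)%:R - m%:R = - e.+1%:R :> K.
    by rewrite em; ring.
  have -> : (m - (i + j).+1)%N = e by lia.
  rewrite !gbinomN (_ : ((i + j).+1 == _) = false); last by lia.
  have -> : 'C(k + e, e) = 'C(e + k, k).
    by rewrite -[in RHS]bin_sub ?leq_addl // addnK addnC.
  rewrite mulrA -exprD -rmorphD -mulrDl /=.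
  rewrite (_ : (m + k.+1 + (i + j)).+1 + e = k.+1 + (i+j+e).+1.*2)%N; last by lia.
  by rewrite -signr_odd oddD odd_double addbF signr_odd exprS mulN1r addNr mul0r.
rewrite add0r -natrB // gbinom_nat.
have [lt|] := ltnP (i + j - m) k.
  by rewrite bin_small // (_ : ((i + j).+1 == _) = false) //; lia.
move=> gek; have -> : (i + j - m)%N = k by lia.
by rewrite binn (_ : ((i + j).+1 == _) = true) //; lia.
Qed.

(** If G(i, l+1) = G(i+1, l) - G(i, l), then G(i, l) is the value at
    s^i (s-1)^l of the linear functional that sends s^c to G(c, 0). *)
Lemma sum_coef_newton (K : nzRingType) (V : lmodType K) (G : nat -> nat -> V) N :
  (forall i l, G i l.+1 = G i.+1 l - G i l) ->
  forall i l, (i + l < N)%N ->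
  \sum_(c < N) ('X^i * ('X - 1) ^+ l : {poly K})`_c *: G c 0%N = G i l.
Proof.
move=> GS i l; elim: l i => [|l IHl] i lt.
  rewrite addn0 in lt; rewrite expr0 mulr1 (bigD1 (Ordinal lt)) //= big1.
    by rewrite coefXn eqxx scale1r addr0.
  by move=> c /negPf; rewrite coefXn -val_eqE /= => ->; rewrite scale0r.
rewrite GS -!IHl ?(leq_trans _ lt) ?addnS ?addSn // -sumrB; apply: eq_bigr => c _.
by rewrite -scalerBl -coefB exprS mulrBl mul1r mulrBr mulrA -exprSr.
Qed.

(** In the columns attached to s^min(j,m) (s-1)^(j-m) the matrix Phi is lower
    triangular: these polynomials vanish at 0 to order min(j, m) and at 1 to order
    j - m.  As they are monic of degree j, the change of columns has
    determinant 1. *)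
Lemma ndet_wronsk_row (K : numFieldType) m n (a : K) :
  ndet (m + n) (wronsk_row m a) = (-1) ^+ 'C(m, 2).
Proof.
pose p j : {poly K} := 'X^(minn j m) * ('X - 1) ^+ (j - m)%N.
have p_monic j : p j \is monic.
  by rewrite monicMl ?monicXn // monic_exp // -polyC1 monicXsubC.
have size_p j : size (p j) = j.+1.
  rewrite size_Mmonic ?monic_neq0 ?monicXn //; last first.
    by rewrite monic_exp // -polyC1 monicXsubC.
  by rewrite size_polyXn -polyC1 size_exp_XsubC; lia.
(* the functional of row c at s^i (s-1)^l; G c i 0 is its value at s^i *)
pose G c i l : {poly K} :=
  if (c < m)%N then (-1) ^+ (i + l) * laguerre_shift c i (a + (i + l)%:R)
  else laguerre_shift (c - m) l (a + (i + l)%:R) \Po (- 'X).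
have G0 c i : G c i 0%N = wronsk_row m a c i.
  by rewrite /G /wronsk_row addn0 derivn_laguerre /laguerre_shift subn0.
have GS c i l : G c i l.+1 = G c i.+1 l - G c i l.
  rewrite /G addnS addSn -natr1 addrA; case: ifP => _.
    by rewrite laguerre_shift_pascal exprS; ring.
  by rewrite [in RHS]laguerre_shift_pascal comp_polyD [RHS]addrAC subrr add0r.
pose U : 'M[{poly K}]_(m + n) := \matrix_(i, j) ((p j)`_i)%:P.
have detU : \det U = 1.
  rewrite -det_tr det_trig; last first.
    apply/is_trig_mxP => i j lt; rewrite !mxE nth_default ?polyC0 //.
    by rewrite size_p.
  rewrite big1 // => i _; rewrite !mxE.
  by have /monicP := p_monic i; rewrite lead_coefE size_p => ->.
rewrite -[LHS]mulr1 -[X in _ * X = _]detU /ndet -det_mulmx.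
have entry c j : ((\matrix_(i < m + n, j < m + n) wronsk_row m a i j) *m U) c j =
    G c (minn j m) (j - m)%N.
  rewrite -(@sum_coef_newton _ _ (G c) (m + n)) //; last first.
    by have := ltn_ord j; lia.
  rewrite mxE; apply: eq_bigr => i _.
  by rewrite !mxE G0 mulrC mul_polyC.
rewrite det_trig; last first.
  apply/is_trig_mxP => c j lt; rewrite entry /G /laguerre_shift.
  have [lt_cm|le_mc] := ltnP c m.
    by rewrite (_ : (minn j m <= c)%N = false) ?mulr0 //; lia.
  by rewrite (_ : (j - m <= c - m)%N = false) ?comp_poly0 //; lia.
under eq_bigr => c _ do rewrite entry.
rewrite big_split_ord /= [X in _ * X]big1 ?mulr1.
  rewrite -triangular_sum big_mkord -prodrXr; apply: eq_bigr => c _.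
  rewrite /G ltn_ord /laguerre_shift /minn ltn_ord leqnn subnn laguerre0 mulr1.
  by have /eqP -> : (c - m == 0)%N; rewrite ?addn0 // subn_eq0 ltnW.
move=> c _; rewrite /G ltnNge leq_addr /= addKn /laguerre_shift leqnn subnn.
by rewrite laguerre0 comp_polyC.
Qed.

(** * Finite sets of row indices and their signs *)

(** max F + 1, a natural number also when F is empty and max F = -1. *)
Definition fbound (F : {fset nat}) : nat :=
  if F == fset0 then 0%N else (\max_(f <- F) f).+1%N.

Lemma intr_fmax (K : numFieldType) F : (fmax F)%:~R = (fbound F)%:R - 1 :> K.
Proof.
rewrite /fmax /fbound; case: eqP => _; first by rewrite sub0r rmorphN1.
by rewrite -natr1 addrK.
Qed.

Lemma lt_fbound F f : f \in F -> (f < fbound F)%N.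
Proof.
rewrite /fbound; case: eqP => [->|_]; first by rewrite in_fset0.
by move=> Ff; rewrite ltnS (@leq_bigmax_seq _ _ xpredT id).
Qed.

Lemma size_fenum F : size (fenum F) = #|` F|.
Proof. by rewrite size_sort. Qed.

Lemma eq_fenum F s :
  sorted ltn s -> s =i F -> fenum F = s.
Proof.
move=> s_sorted sF; apply: (irr_sorted_eq ltn_trans ltnn) => //.
  rewrite ltn_sorted_uniq_leq sort_uniq fset_uniq.
  by rewrite sort_sorted //; exact: leq_total.
by move=> c; rewrite mem_sort sF.
Qed.

Lemma fenumE F m : (forall f, f \in F -> (f < m)%N) ->
  fenum F = [seq c <- iota 0 m | c \in F].
Proof.
move=> Fm; apply: eq_fenum.
  by rewrite sorted_filter ?iota_ltn_sorted //; exact: ltn_trans.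
by move=> c; rewrite mem_filter mem_iota; case: (boolP (c \in F)) => // /Fm ->.
Qed.

Definition fgap F : seq nat := [seq c <- iota 0 (fbound F) | c \notin F].

(** The reflection c |-> max F - c exchanges I(F) and the complement of F, and
    it reverses the order; hence the reversed blocks of Y. *)
Lemma fenum_iset F :
  fenum (iset F) = [seq (fbound F - c.+1)%N | c <- rev (fgap F)].
Proof.
apply: eq_fenum.
  rewrite map_rev rev_sorted sorted_map.
  apply: (@sub_in_sorted _ [pred c | c < fbound F]%N ltn); last first.
  - by rewrite sorted_filter ?iota_ltn_sorted //; exact: ltn_trans.
  - by apply/allP => c; rewrite mem_filter mem_iota => /andP[].
  by move=> c d; rewrite !inE /=; lia.
move=> x; rewrite /iset /fgap /fbound; case: eqP => [->|_].
  by rewrite in_fset0.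
set M := (\max_(f <- F) f)%N.
have leM f : f \in F -> (f <= M)%N.
  by move=> Ff; rewrite /M (@leq_bigmax_seq _ _ xpredT id).
rewrite in_fsetD in_fset mem_iota add0n ltnS leq0n andTb.
apply/mapP/andP => [[c]|[xnI]].
  rewrite mem_rev mem_filter mem_iota add0n ltnS subSS => /andP[cF le] ->.
  rewrite leq_subr; split=> //.
  apply: contra cF => /imfsetP[f /= Ff e].
  by rewrite (_ : c = f) //; have := leM f Ff; lia.
move=> le_x; exists (M - x)%N.
  rewrite mem_rev mem_filter mem_iota add0n ltnS leq_subr !andbT.
  apply: contra xnI => MxF; apply/imfsetP.
  by exists (M - x)%N => //=; rewrite subKn.
by rewrite subSS subKn.
Qed.

Lemma size_fgap F : size (fgap F) = #|` iset F|.
Proof. by rewrite -size_fenum fenum_iset size_map size_rev. Qed.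

(** The rows of Phi selected by (F1, F2), as a predicate on row numbers. *)
Definition pair_rows m (F1 F2 : {fset nat}) (c : nat) : bool :=
  if (c < m)%N then c \in F1 else (c - m)%N \in F2.

Lemma filter_pair_rows (F1 F2 : {fset nat}) m n (op : bool -> bool) :
  [seq c <- iota 0 (m + n) | op (pair_rows m F1 F2 c)] =
  [seq c <- iota 0 m | op (c \in F1)] ++
  [seq (m + c)%N | c <- [seq c <- iota 0 n | op (c \in F2)]].
Proof.
rewrite iotaD filter_cat; congr (_ ++ _).
  by apply: eq_in_filter => c; rewrite mem_iota /= add0n /pair_rows => ->.
rewrite add0n -[X in iota X n]addn0 iotaDl filter_map; congr map.
by apply: eq_filter => c; rewrite /= /pair_rows ltnNge leq_addr /= addKn.
Qed.

Lemma det_qwronsk_mx (K : numFieldType) (a : K) (F1 F2 : {fset nat}) m :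
  (forall f, f \in F1 -> (f < m)%N) ->
  \det (qwronsk_mx a F1 F2) =
  ndet (#|` F1| + #|` F2|) (fun i =>
    wronsk_row m a (nth 0%N (fenum F1 ++ [seq (m + c)%N | c <- fenum F2]) i)).
Proof.
move=> F1m; congr (\det _); apply/matrixP => i j.
rewrite !mxE nth_cat size_fenum; case: splitP => i' ei; rewrite mxE ei.
  rewrite /wronsk_row (F1m _ _) //.
  by rewrite -(mem_sort leq) mem_nth // size_fenum.
rewrite addKn (nth_map 0%N) ?size_fenum //.
by rewrite /wronsk_row ltnNge leq_addr /= addKn.
Qed.

Definition antidiag (R : comNzRingType) n : 'M[R]_n :=
  \matrix_(i, j) ((i + j).+1 == n)%N%:R.

Lemma det_antidiag (R : comNzRingType) n :
  \det (antidiag R n) = (-1) ^+ 'C(n, 2).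
Proof.
rewrite -(@ndet_antitrig _ n (fun i j => ((i + j).+1 == n)%N%:R)) //.
  by move=> i j /ltn_eqF ->.
by move=> i j ->; rewrite eqxx.
Qed.

Lemma mul_antidiag (R : comNzRingType) n p (A : 'M[R]_(n, p)) i j :
  (antidiag R n *m A) i j = A (rev_ord i) j.
Proof.
rewrite mxE (bigD1 (rev_ord i)) //= big1 ?addr0 => [|c neq].
  rewrite mxE /= (_ : (_ == _) = true) ?mul1r //.
  by have := ltn_ord i; lia.
rewrite mxE (_ : (_ == _) = false) ?mul0r //.
by move: neq; rewrite -val_eqE /=; have := ltn_ord i; lia.
Qed.

Lemma nth_fenum_iset F (i : 'I_(#|` iset F|)) :
  nth 0%N (fenum (iset F)) (rev_ord i) = (fbound F - (nth 0%N (fgap F) i).+1)%N.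
Proof.
rewrite fenum_iset (nth_map 0%N); last by rewrite size_rev size_fgap.
rewrite nth_rev size_fgap ?ltn_ord //=.
by have /(congr1 val) /= -> := rev_ordK i.
Qed.

Lemma nth_fgap F i : (i < #|` iset F|)%N -> (nth 0%N (fgap F) i < fbound F)%N.
Proof.
rewrite -size_fgap => lt; have := mem_nth 0%N lt.
by rewrite mem_filter mem_iota => /andP[_].
Qed.

Lemma ndet_dual_row (K : numFieldType) (b : K) (F1 F2 : {fset nat}) :
  let m := fbound F1 in let n := fbound F2 in
  let r1 := #|` iset F1| in let r2 := #|` iset F2| in
  ndet (r1 + r2) (fun i =>
    dual_row m n b (nth 0%N (fgap F1 ++ [seq (m + c)%N | c <- fgap F2]) i)) =
  (-1) ^+ ((m + n).+1 * r1 + 'C(r1, 2) + 'C(r2, 2)) *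
    (\det (qwronsk_mx b (iset F1) (iset F2)) \Po (- 'X)).
Proof.
move=> m n r1 r2.
rewrite -[_ \Po _]/((comp_poly (- 'X)) _) -det_map_mx /qwronsk_mx map_col_mx.
set W1 := map_mx _ _; set W2 := map_mx _ _.
have -> : (-1) ^+ ((m + n).+1 * r1 + 'C(r1, 2) + 'C(r2, 2)) =
    \det (block_mx ((-1) ^+ (m + n).+1 *: antidiag {poly K} r1) 0
                   0 (antidiag {poly K} r2)).
  by rewrite det_lblock detZ !det_antidiag -exprM !exprD.
rewrite -det_mulmx mul_block_col !mul0mx add0r addr0 -scalemxAl.
congr (\det _); apply/matrixP => i j.
rewrite !mxE nth_cat size_fgap -/r1; case: splitP => i' ei; rewrite ei.
  rewrite mxE mul_antidiag !mxE nth_fenum_iset /dual_row nth_fgap //.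
rewrite addKn (nth_map 0%N) ?size_fgap //.
rewrite mul_antidiag !mxE nth_fenum_iset /dual_row ltnNge leq_addr /=.
rewrite -addnS subnDl.
rewrite -[RHS]/((_ \Po _) \Po _) -comp_polyA.
by rewrite rmorphN /= comp_polyX opprK comp_polyXr.
Qed.

Lemma sum_fenum (F : {fset nat}) : (\sum_(f <- F) f = \sum_(f <- fenum F) f)%N.
Proof. by apply: perm_big; rewrite perm_sym perm_sort. Qed.

Lemma sum_fset_fgap (F : {fset nat}) :
  (\sum_(f <- fenum F) f + \sum_(f <- fgap F) f = 'C(fbound F, 2))%N.
Proof.
rewrite (fenumE (@lt_fbound F)) /fgap !big_filter.
rewrite -triangular_sum /index_iota subn0.
by rewrite [RHS](bigID (fun c => c \in F)).
Qed.

Lemma sum_iset (F : {fset nat}) :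
  (\sum_(f <- fenum (iset F)) f + \sum_(f <- fgap F) f + #|` iset F| =
   #|` iset F| * fbound F)%N.
Proof.
rewrite fenum_iset big_map (perm_big (fgap F)) ?perm_rev //=.
rewrite -size_fgap -[X in (_ + X)%N]sum1_size -!big_split /=.
rewrite (eq_big_seq (fun=> fbound F)) => [|c]; last first.
  by rewrite mem_filter mem_iota => /andP[_ lt]; lia.
by rewrite big_const_seq iter_addn_0 count_predT mulnC.
Qed.

Lemma addn_card_iset F : (#|` F| + #|` iset F| = fbound F)%N.
Proof.
rewrite -size_fenum -size_fgap (fenumE (@lt_fbound F)) /fgap !size_filter.
by rewrite count_predC size_iota.
Qed.

Lemma exprN1z (R : unitRingType) (a b : nat) :
  (-1) ^ (a%:Z - b%:Z) = (-1) ^+ (a + b) :> R.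
Proof. by rewrite exprzDr ?unitrN1 // -exprz_inv invrN1 exprD. Qed.

Lemma signr_wpair (K : numFieldType) (F1 F2 : {fset nat}) :
  (-1) ^ wpair (F1, F2) =
  (-1) ^+ (\sum_(f <- fenum F1) f + \sum_(f <- fenum F2) f +
           ('C(#|` F1|, 2) + 'C(#|` F2|, 2)))%N :> {poly K}.
Proof.
rewrite -exprN1z /wpair /wset !sum_fenum; congr (_ ^ _).
by rewrite !PoszD opprD addrACA.
Qed.

Lemma bin2D a b : 'C(a + b, 2) = ('C(a, 2) + 'C(b, 2) + a * b)%N.
Proof.
elim: a => [|a IHa]; first by rewrite !addn0.
by rewrite addSn !binS !bin1 IHa; lia.
Qed.

(** Jacobi's identity is applied to the rows of Phi and Y rearranged by the shuffle
    of the rows selected by (F1, F2), which moves the two minors into opposite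
    corners and leaves E^T Y unchanged. *)
Lemma qwronsk_dual (K : numFieldType) (a : K) (F1 F2 : {fset nat}) :
  qwronsk a (F1, F2) =
  (-1) ^ wpair (F1, F2) *
  (qwronsk (- a - (fmax F1)%:~R - (fmax F2)%:~R - 2%:R) (ipair (F1, F2))
     \Po (- 'X)).
Proof.
have -> : - a - (fmax F1)%:~R - (fmax F2)%:~R - 2%:R =
    - a - (fbound F1)%:R - (fbound F2)%:R.
  by rewrite !intr_fmax; ring.
set b := _ - _ - _; rewrite /qwronsk /ipair /=.
rewrite -[_ \Po _]/((comp_poly (- 'X)) _) rmorphM rmorph_sign /=.
have := @ndet_dual_row K b F1 F2; rewrite /=.
set m := fbound F1; set n := fbound F2.
have Fm f : f \in F1 -> (f < m)%N by exact: lt_fbound.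
have Fn f : f \in F2 -> (f < n)%N by exact: lt_fbound.
set k1 := #|` F1|; set k2 := #|` F2|.
set r1 := #|` iset F1|; set r2 := #|` iset F2|.
set W := _ \Po _ => dualW.
have em : (k1 + r1 = m)%N by exact: addn_card_iset.
have en : (k2 + r2 = n)%N by exact: addn_card_iset.
have eN : ((k1 + k2) + (r1 + r2) = m + n)%N by rewrite addnACA em en.
pose s := shuffle (pair_rows m F1 F2) (m + n).
pose S := fenum F1 ++ [seq (m + c)%N | c <- fenum F2].
have sE : s = S ++ (fgap F1 ++ [seq (m + c)%N | c <- fgap F2]).
  rewrite /s /shuffle (filter_pair_rows _ _ _ _ id).
  rewrite (filter_pair_rows _ _ _ _ negb).
  by rewrite /S (fenumE Fm) (fenumE Fn).
have sizeS : size S = (k1 + k2)%N by rewrite size_cat size_map !size_fenum.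
have := ndet_shuffle (pair_rows m F1 F2) (m + n) (wronsk_row m a).
rewrite (filter_pair_rows _ _ _ _ id) -(fenumE Fm) -(fenumE Fn) -/S sizeS -/s.
rewrite ndet_wronsk_row -eN => detX.
have s_perm : perm_eq s (iota 0 (m + n)).
  apply: uniq_perm; rewrite ?iota_uniq //; last first.
    by move=> c; rewrite mem_shuffle mem_iota.
  rewrite cat_uniq !filter_uniq ?iota_uniq //= andbT.
  by apply/hasPn => c; rewrite !mem_filter => /andP[/negPf -> _].
have sum_s i j : ((i + j).+1 <= m + n)%N ->
    \sum_(c < m + n)
      wronsk_row m a (nth 0%N s c) i * dual_row m n b (nth 0%N s c) j =
    ((i + j).+1 == m + n)%N%:R.
  move=> lt; rewrite -(sum_wronsk_row_dual_row a lt) -/b.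
  transitivity (\sum_(c <- s) wronsk_row m a c i * dual_row m n b c j).
    by rewrite (big_nth 0%N) size_shuffle big_mkord.
  by rewrite (perm_big _ s_perm) /= -{1}[(m + n)%N]subn0 big_mkord.
pose G i j := \sum_(c < m + n)
  wronsk_row m a (nth 0%N s c) i * dual_row m n b (nth 0%N s c) j.
have compl : ndet (k1 + k2 + (r1 + r2)) (fun i => wronsk_row m a (nth 0%N s i)) *
      ndet (r1 + r2) (fun i => dual_row m n b (nth 0%N s (k1 + k2 + i))) =
    ndet (k1 + k2) (fun i => wronsk_row m a (nth 0%N s i)) *
      (-1) ^+ 'C(r1 + r2, 2).
  rewrite -(@ndet_antitrig _ _ (fun i => G (k1 + k2 + i)%N)).
  - apply: (@ndet_complement _ _ _ (fun i => wronsk_row m a (nth 0%N s i))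
      (fun i => dual_row m n b (nth 0%N s i)) G)
      => [i j _ _|i j lt_i lt_j]; first by rewrite eN.
    by rewrite /G sum_s -eN; [rewrite ltn_eqF //; lia | lia].
  - by move=> i j lt; rewrite /G sum_s -eN; [rewrite ltn_eqF //; lia | lia].
  - by move=> i j e; rewrite /G sum_s -eN -addnA -addnS e ?eqxx.
rewrite (_ : ndet (k1 + k2) _ = \det (qwronsk_mx a F1 F2)) in compl; last first.
  rewrite (det_qwronsk_mx _ _ Fm); apply: eq_ndet => i j lt_i _.
  by rewrite sE nth_cat sizeS lt_i.
rewrite (_ : ndet (r1 + r2) _ =
    (-1) ^+ ((m + n).+1 * r1 + 'C(r1, 2) + 'C(r2, 2)) * W) in compl; last first.
  rewrite -dualW; apply: eq_ndet => i j lt_i _.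
  by rewrite sE nth_cat sizeS ltnNge leq_addr /= addKn.
have {compl detX} -> : \det (qwronsk_mx a F1 F2) =
    (-1) ^+ (\sum_(c <- S) c + 'C(k1 + k2, 2) + 'C(m, 2) +
             ((m + n).+1 * r1 + 'C(r1, 2) + 'C(r2, 2)) + 'C(r1 + r2, 2)) * W.
  move/(congr1 (fun p => p * (-1) ^+ 'C(r1 + r2, 2))): compl.
  rewrite -[RHS]mulrA -expr2 sqrr_sign mulr1 => <-.
  by rewrite detX !mulrA mulrAC -!exprD.
rewrite signr_wpair !mulrA -!exprD; congr (_ * W).
rewrite -[LHS]signr_odd -[RHS]signr_odd; congr (_ ^+ nat_of_bool _).
rewrite big_cat big_map big_split /= -/k1 -/k2.
have -> : (\sum_(c <- fenum F2) m = m * k2)%N.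
  by rewrite big_const_seq iter_addn_0 count_predT size_fenum.
rewrite !sum_fenum; move: (sum_fset_fgap F1) (sum_iset F1); rewrite -/m -/r1.
move: (\sum_(f <- fenum F1) f)%N (\sum_(f <- fenum F2) f)%N.
move: (\sum_(f <- fgap F1) f)%N (\sum_(f <- fenum (iset F1)) f)%N.
move=> t1 i1 f1 f2 e1 e2; have odd_eq u v : ~~ odd (u + v) -> odd u = odd v.
  by rewrite oddD; case: (odd u); case: (odd v).
(* the two exponents add up to an even number because m = k1 + r1, n = k2 + r2,
   and by the values of sum F1 + t1 and sum I(F1) + t1 *)
apply: odd_eq; rewrite !bin2D -e1.
rewrite (_ : (_ + _)%N = (2 * f1 + f2 + 'C(k1, 2) + 'C(k2, 2) + 'C(r1, 2) +
   'C(r2, 2) + k1 * k2 + r1 * k2 + r1 * r2 + m * r1).*2)%N ?odd_double //.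
by move: e2; rewrite -em -en; nia.
Qed.

Theorem theorem6p1 (R : realType) (alpha : R[i])
    (FF : {fset nat} * {fset nat}) :
  qwronsk alpha FF =
  (-1) ^ wpair FF *
  (qwronsk (- alpha - (fmax FF.1)%:~R - (fmax FF.2)%:~R - 2%:R) (ipair FF)
     \Po (- 'X)).
Proof.
by case: FF => F1 F2; apply: qwronsk_dual.
Qed.
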